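(* For $n\geq 0$, $$F_n^I(x,y,q)=\sum_{2k\leq n}\binom{n-k}{k}x^{n-2k}y^kq^{\binom{n}{2}-k}.$$
   Context: $S_n(123,132,213)$ is the set of permutations of $[n]$ with no subsequence order isomorphic to $123$, $132$ or $213$; each such $\pi$ is a concatenation of increasing blocks of size $1$ or $2$, each block larger than all later blocks. $s(\pi)$, $d(\pi)$ are the numbers of maximal increasing runs of $\pi$ of length $1$ and $2$, and $inv(\pi)$ is the number of inversions. $F_n^I(x,y,q)=\sum_{\pi\in S_n(123,132,213)}x^{s(\pi)}y^{d(\pi)}q^{inv(\pi)}$. *)

(* Defs.v *)
From mathcomp Require Import all_boot all_order all_fingroup all_algebra.
Set Implicit Arguments.
Unset Strict Implicit.
Unset Printing Implicit Defensive.

Import GRing.Theory.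

(* One-line notation of a permutation; 'I_n is 0-based, hence the successor. *)
Definition one_line (n : nat) (pi : 'S_n) : seq nat :=
  [seq (pi i).+1 | i <- enum 'I_n].

Definition order_isomorphic (u v : seq nat) : bool :=
  (size u == size v) &&
  [forall i : 'I_(size u), forall j : 'I_(size u),
     (nth 0 u i < nth 0 u j) == (nth 0 v i < nth 0 v j)].

(* The masks of length [size w] select exactly the subsequences of [w]. *)
Definition contains_pattern (p w : seq nat) : bool :=
  [exists m : (size w).-tuple bool, order_isomorphic (mask m w) p].

Definition avoiders (n : nat) (ps : seq (seq nat)) : {set 'S_n} :=
  [set pi : 'S_n | all (fun p => ~~ contains_pattern p (one_line pi)) ps].

Fixpoint runs (w : seq nat) : seq (seq nat) :=
  if w is a :: w' then
    if runs w' is (b :: r) :: rs then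
      if a < b then (a :: b :: r) :: rs else [:: a] :: (b :: r) :: rs
    else [:: [:: a]]
  else [::].

(* The next three facts say that [runs w] cuts [w] into nonempty increasing
   factors with a non-ascent at each cut, so that these factors are maximal. *)
Lemma runs_shape a w : exists r rs, runs (a :: w) = (a :: r) :: rs.
Proof.
rewrite /=; case: (runs w) => [|[|b r] rs]; [by exists [::], [::] .. |].
by case: ifP => _; [exists (b :: r), rs | exists [::], ((b :: r) :: rs)].
Qed.

Lemma flatten_runs w : flatten (runs w) = w.
Proof.
elim: w => //= a [|b w] IHw //.
have [r [rs e]] := runs_shape b w; move: IHw; rewrite e /= => IHw.
by case: ifP => _ /=; rewrite IHw.
Qed.

Lemma runs_maximal w :
  all (sorted ltn) (runs w) &&
  sorted (fun r1 r2 => head 0 r2 <= last 0 r1) (runs w).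
Proof.
elim: w => //= a [|b w] IHw //.
have [r [rs e]] := runs_shape b w; move: IHw; rewrite e /=.
case/andP=> /andP[sr srs] p; case: ltnP => ab /=; rewrite ?ab ?sr ?srs //=.
by case: rs p {e srs}.
Qed.

Definition nb_runs (l : nat) (w : seq nat) : nat :=
  count (fun r => size r == l) (runs w).

Definition s_stat (n : nat) (pi : 'S_n) : nat := nb_runs 1 (one_line pi).

Definition d_stat (n : nat) (pi : 'S_n) : nat := nb_runs 2 (one_line pi).

Definition inv_stat (n : nat) (pi : 'S_n) : nat :=
  #|[set ij : 'I_n * 'I_n | (ij.1 < ij.2) && (pi ij.2 < pi ij.1)]|.

(* Polynomials in x, y, q are written as expressions in elements of a
   commutative ring; the indeterminates are the case of a polynomial ring. *)
Definition F_I (R : comNzRingType) (n : nat) (x y q : R) : R :=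
  (\sum_(pi in avoiders n [:: [:: 1; 2; 3]; [:: 1; 3; 2]; [:: 2; 1; 3]]%N)
     x ^+ s_stat pi * y ^+ d_stat pi * q ^+ inv_stat pi)%R.

(* Main.v *)
(** The patterns 123, 132 and 213 are exactly those of length three whose first
letter is smaller than the last one.  Hence a permutation avoids them iff every
letter is larger than all letters at distance at least two to its right.  The
largest letter [n + 2] is thus first, or it is second and then preceded by
[n + 1]; deleting this first block, of size one or two, removes [n + 1] or [2n]
inversions and one run.  Both sides of the identity therefore satisfy
[F (n + 2) = x q^(n + 1) F (n + 1) + y q^(2 n) F n]. *)
Require Import Defs.
From mathcomp Require Import all_boot all_order all_fingroup all_algebra.
From mathcomp Require Import zify ring.

Import GRing.Theory.
Local Open Scope ring_scope.

(** * Word models of the avoiders and of the inversion number *)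

Section Words.
Local Set Implicit Arguments.
Local Unset Strict Implicit.
Local Open Scope nat_scope.

Implicit Types (n a : nat) (u v w p : seq nat).

Fixpoint far_decreasing w : bool :=
  if w is a :: w' then all (fun c => c < a) (behead w') && far_decreasing w'
  else true.

Fixpoint word_inv w : nat :=
  if w is a :: w' then count (fun c => c < a) w' + word_inv w' else 0.

Fixpoint block_words n : seq (seq nat) :=
  (* The first block is either the maximum alone or the two largest letters in increasing order. *)
  match n with
  | 0 => [:: [::]]
  | n1.+1 =>
    match n1 with
    | 0 => [:: [:: 1]]
    | n2.+1 => [seq n :: w | w <- block_words n1]
               ++ [seq n1 :: n :: w | w <- block_words n2]
    end
  end.

Lemma block_wordsSS n : block_words n.+2 =
  [seq n.+2 :: w | w <- block_words n.+1]
  ++ [seq n.+1 :: n.+2 :: w | w <- block_words n].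
Proof. by []. Qed.

Arguments block_words : simpl never.

Lemma nat_ind2 (P : nat -> Prop) :
  P 0 -> P 1 -> (forall n, P n -> P n.+1 -> P n.+2) -> forall n, P n.
Proof.
move=> P0 P1 PS n; suff [] : P n /\ P n.+1 by [].
by elim: n => [|n [Pn PSn]]; split=> //; apply: PS.
Qed.

(** * Avoidance as a condition on letters at distance at least two *)

Lemma order_isomorphicP u v :
  reflect (size u = size v /\
           forall i j, i < size u -> j < size u ->
             (nth 0 u i < nth 0 u j) = (nth 0 v i < nth 0 v j))
          (order_isomorphic u v).
Proof.
apply: (iffP andP) => [[/eqP eq_sz /forallP H]|[-> H]]; split=> //.
- move=> i j lti ltj; by move: (H (Ordinal lti)) => /forallP/(_ (Ordinal ltj))/eqP.
- by apply/forallP=> i; apply/forallP=> j; rewrite H.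
Qed.

Lemma contains_patternP p w :
  reflect (exists2 u, subseq u w & order_isomorphic u p) (contains_pattern p w).
Proof.
apply: (iffP existsP) => [[m iso]|[u /subseqP[m sz_m ->] iso]].
  by exists (mask m w); rewrite ?mask_subseq.
by exists (Tuple (introT eqP sz_m)).
Qed.

Lemma far_decreasingP w :
  reflect (forall a b c, subseq [:: a; b; c] w -> c < a) (far_decreasing w).
Proof.
elim: w => [|d w IH]; first by apply: ReflectT => a b c.
apply: (iffP andP) => [[/allP Hd /IH Hw] a b c | H].
  rewrite [subseq _ _]/=; case: eqP => [-> | _]; last exact: Hw.
  case: w Hd {IH Hw} => // e w Hd sub; apply: Hd.
  have /mem_subseq : subseq [:: c] w.
    move: sub; rewrite [subseq _ _]/=; case: eqP => // _ sub.
    by apply: subseq_trans sub; apply: subseq_cons.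
  by apply; rewrite mem_head.
split; last first.
  apply/IH => a b c sub; apply: (H a b c).
  exact: subseq_trans sub (subseq_cons _ _).
(* The right neighbour [e] of [d] serves as the middle letter of the triple. *)
case: w {IH} H => // e w H; apply/allP=> c cw.
by apply: (H d e c); rewrite /= !eqxx sub1seq.
Qed.

(** If [a < c] in a triple [a, b, c] of distinct letters, then [b] lies below both, between them or
    above both, which gives 213, 123 or 132. *)
Lemma avoids_far_decreasing w : uniq w ->
  all (fun p => ~~ contains_pattern p w)
      [:: [:: 1; 2; 3]; [:: 1; 3; 2]; [:: 2; 1; 3]] = far_decreasing w.
Proof.
move=> Uw; apply/idP/idP => [/= /and4P[H123 H132 H213 _] | /far_decreasingP H].
  apply/far_decreasingP=> a b c sub; rewrite ltnNge; apply/negP=> le_ac.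
  have : uniq [:: a; b; c] by apply: subseq_uniq sub Uw.
  rewrite /= !inE => /and3P[/norP[/eqP nab /eqP nac] /eqP nbc _].
  have iso p : size p = 3 ->
      (a < b) = (nth 0 p 0 < nth 0 p 1) -> (b < a) = (nth 0 p 1 < nth 0 p 0) ->
      (a < c) = (nth 0 p 0 < nth 0 p 2) -> (c < a) = (nth 0 p 2 < nth 0 p 0) ->
      (b < c) = (nth 0 p 1 < nth 0 p 2) -> (c < b) = (nth 0 p 2 < nth 0 p 1) ->
    contains_pattern p w.
    move=> sz_p e1 e2 e3 e4 e5 e6; apply/contains_patternP.
    exists [:: a; b; c] => //; apply/order_isomorphicP; split=> //.
    by case=> [|[|[|i]]] // [|[|[|j]]] //=; rewrite !ltnn.
  have [ba|ab] := ltnP b a; first by move/negP: H213; apply; apply: iso => /=; lia.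
  have [bc|cb] := ltnP b c; first by move/negP: H123; apply; apply: iso => /=; lia.
  by move/negP: H132; apply; apply: iso => /=; lia.
have no p : size p = 3 -> nth 0 p 0 < nth 0 p 2 -> ~~ contains_pattern p w.
  move=> sz_p p02; apply/contains_patternP=> -[u sub /order_isomorphicP[sz_u iso]].
  move: sz_u sub iso; rewrite sz_p; case: u => [|a [|b [|c []]]] // _ /H ca.
  by move/(_ 0 2 isT isT); rewrite p02 /=; lia.
by rewrite /= !no.
Qed.

(** * Permutations generated block by block *)

Lemma perm_iotaS n : perm_eq (n.+1 :: iota 1 n) (iota 1 n.+1).
Proof.
have -> : iota 1 n.+1 = iota 1 n ++ [:: n.+1] by rewrite -[n.+1]addn1 iotaD add1n addn1.
by rewrite -cat1s perm_catC.
Qed.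

Lemma block_words_perm n w : w \in block_words n -> perm_eq w (iota 1 n).
Proof.
elim/nat_ind2: n w => [||n IH0 IH1] w; [by rewrite inE => /eqP-> .. |].
rewrite block_wordsSS mem_cat => /orP[] /mapP[v v_in ->].
  by apply: perm_trans (perm_iotaS _); rewrite perm_cons IH1.
apply: perm_trans (perm_iotaS _); rewrite -cat1s -[n.+2 :: v]cat1s perm_catCA.
by rewrite perm_cons /=; apply: perm_trans (perm_iotaS _); rewrite perm_cons IH0.
Qed.

Lemma block_words_le n w : w \in block_words n -> all (fun c => c <= n) w.
Proof.
move/block_words_perm => pw; apply/allP=> c.
by rewrite (perm_mem pw) mem_iota; lia.
Qed.

Lemma block_words_size n w : w \in block_words n -> size w = n.
Proof. by move/block_words_perm/perm_size; rewrite size_iota. Qed.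

Lemma block_words_uniq n : uniq (block_words n).
Proof.
elim/nat_ind2: n => // n IH0 IH1; rewrite block_wordsSS cat_uniq.
rewrite !map_inj_uniq ?IH0 ?IH1 /= ?andbT; try by move=> u v [].
apply/hasPn=> _ /mapP[v _ ->]; apply/negP=> /mapP[u _ [/eqP]].
by rewrite ltn_eqF.
Qed.

Lemma mem_block_words n w :
  (w \in block_words n) = perm_eq w (iota 1 n) && far_decreasing w.
Proof.
apply/idP/andP=> [w_in | []].
  split; first exact: block_words_perm.
  elim/nat_ind2: n w w_in => [||n IH0 IH1] w; [by rewrite inE => /eqP-> .. |].
  rewrite block_wordsSS mem_cat => /orP[] /mapP[v v_in ->] /=.
    rewrite IH1 // andbT; apply/allP=> c /mem_behead.
    by move/(allP (block_words_le v_in)).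
  rewrite IH0 // andbT; apply/andP; split.
    by apply: sub_all (block_words_le v_in) => c.
  by apply/allP=> c /mem_behead/(allP (block_words_le v_in)) /leqW.
elim/nat_ind2: n w => [||n IH0 IH1] w.
- by move/perm_nilP->.
- by move/perm_small_eq=> -> //.
have perm_iotaSr m : perm_eq (iota 1 m.+1) (m.+1 :: iota 1 m).
  by rewrite perm_sym perm_iotaS.
move=> pw; have := perm_mem pw; case: w pw => [/perm_size //|a w] pw mem_w.
(* The largest letter [n.+2] is either the first letter or in the tail. *)
have := mem_w n.+2; rewrite mem_iota inE add1n !ltnS leqnn /=.
case/orP=> [/eqP ea /andP[_ fw]|n2w].
  rewrite -ea in pw *; rewrite block_wordsSS mem_cat map_f // IH1 //.
  by rewrite -(perm_cons n.+2); apply: perm_trans pw (perm_iotaSr _).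
case: w n2w pw mem_w => // b w n2w pw mem_w /and3P[w_a _ fw].
have a_le : a <= n.+2 by have := mem_w a; rewrite mem_head mem_iota; lia.
(* Letters after [b] are below [a], hence below [n.+2], so [n.+2] can only be [b]. *)
have eb : b = n.+2.
  move: n2w; rewrite inE => /orP[/eqP //|/(allP w_a)]; lia.
have pw' : perm_eq (a :: w) (iota 1 n.+1).
  rewrite -(perm_cons n.+2); apply: perm_trans (perm_iotaSr _).
  by apply: perm_trans pw; rewrite eb -cat1s -[a :: w]cat1s perm_catCA.
(* Once [n.+2] is deleted the maximum is [n.+1], and [a] exceeds all other remaining letters. *)
have ea : a = n.+1.
  have le_a : a <= n.+1 by have := perm_mem pw' a; rewrite mem_head mem_iota; lia.
  have : n.+1 \in a :: w by rewrite (perm_mem pw') mem_iota; lia.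
  by rewrite inE => /orP[/eqP //|/(allP w_a)]; lia.
rewrite block_wordsSS mem_cat eb ea; apply/orP; right; apply: map_f.
apply: IH0 => //; rewrite -(perm_cons n.+1) -{1}ea.
exact: perm_trans pw' (perm_iotaSr _).
Qed.

(** * One-line notation as a bijection onto the rearrangements of [iota 1 n] *)

Lemma one_line_perm n (pi : 'S_n) : perm_eq (one_line pi) (iota 1 n).
Proof.
apply: uniq_perm; rewrite ?iota_uniq //.
  by rewrite map_inj_uniq ?enum_uniq // => i j [/val_inj/perm_inj].
move=> c; rewrite mem_iota; apply/mapP/idP => [[i _ ->] | /andP[c1 cn]].
  by rewrite /= add1n ltnS ltn_ord.
have c_lt : c.-1 < n by lia.
by exists (pi^-1%g (Ordinal c_lt)); rewrite ?mem_enum // permKV /= prednK.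
Qed.

Lemma nth_one_line n (pi : 'S_n) (i : 'I_n) : nth 0 (one_line pi) i = (pi i).+1.
Proof. by rewrite (nth_map i) ?size_enum_ord // nth_ord_enum. Qed.

Lemma one_line_inj n : injective (@one_line n).
Proof.
move=> s t st; apply/permP=> i; apply/val_inj/succn_inj.
by rewrite -!nth_one_line st.
Qed.

Lemma one_line_onto n w : perm_eq w (iota 1 n) -> exists pi : 'S_n, one_line pi = w.
Proof.
move=> pw; have sz_w : size w = n by rewrite (perm_size pw) size_iota.
have Uw : uniq w by rewrite (perm_uniq pw) iota_uniq.
have w_bound i : i < n -> 0 < nth 0 w i <= n.
  move=> lti; have : nth 0 w i \in w by rewrite mem_nth ?sz_w.
  by rewrite (perm_mem pw) mem_iota; lia.
(* Letters start at 1 and ordinals at 0; positivity of the letters keeps the predecessor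
   injective. *)
have w_lt (i : 'I_n) : (nth 0 w i).-1 < n by have := w_bound i (ltn_ord i); lia.
have f_inj : injective (fun i => Ordinal (w_lt i)).
  move=> i j [eq_ij]; apply/val_inj/eqP; rewrite -(nth_uniq 0 _ _ Uw) ?sz_w ?ltn_ord //.
  have /andP[wi _] := w_bound i (ltn_ord i).
  have /andP[wj _] := w_bound j (ltn_ord j).
  by rewrite -(prednK wi) -(prednK wj) eq_ij.
exists (perm f_inj); apply: (@eq_from_nth _ 0).
  by rewrite size_map size_enum_ord sz_w.
move=> i; rewrite size_map size_enum_ord => lti.
rewrite (nth_one_line _ (Ordinal lti)) permE /= prednK //.
by case/andP: (w_bound i lti).
Qed.

(** Both lists are duplicate free with the same members; this turns the sum over permutations into
    one over a recursively built list. *)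
Lemma perm_one_line_avoiders n :
  perm_eq [seq one_line pi | pi <- enum (avoiders n
             [:: [:: 1; 2; 3]; [:: 1; 3; 2]; [:: 2; 1; 3]])]
          (block_words n).
Proof.
have avoid pi : (pi \in avoiders n [:: [:: 1; 2; 3]; [:: 1; 3; 2]; [:: 2; 1; 3]])
    = (one_line pi \in block_words n).
  rewrite inE mem_block_words one_line_perm avoids_far_decreasing //.
  by rewrite (perm_uniq (one_line_perm pi)) iota_uniq.
apply: uniq_perm; rewrite ?block_words_uniq //.
  by rewrite map_inj_uniq ?enum_uniq //; apply: one_line_inj.
move=> w; apply/mapP/idP => [[pi pi_in ->] | w_in].
  by rewrite -avoid -mem_enum.
have [pi e] := one_line_onto (block_words_perm w_in).
by exists pi; rewrite ?mem_enum ?avoid e.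
Qed.

(** * Inversions and runs of words *)

Lemma word_invE w :
  word_inv w = \sum_(i < size w) \sum_(j < size w)
                 ((i < j) && (nth 0 w j < nth 0 w i)).
Proof.
elim: w => [|a w IH] /=; first by rewrite big_ord0.
(* The row of the first position counts the smaller later letters; in the other rows the first
   column is zero. *)
rewrite big_ord_recl IH; congr (_ + _).
  rewrite big_ord_recl /= add0n -sum1_count (big_nth 0) big_mkord big_mkcond.
  by apply: eq_bigr => j _ /=; case: ltnP.
by apply: eq_bigr => i _; rewrite big_ord_recl /= add0n.
Qed.

Lemma inv_statE n (pi : 'S_n) : inv_stat pi = word_inv (one_line pi).
Proof.
have sz : size (one_line pi) = n by rewrite size_map size_enum_ord.
rewrite word_invE sz /inv_stat cardsE -sum1_card big_mkcond /=.
rewrite pair_bigA; apply: eq_bigr => -[i j] _ /=.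
by rewrite !nth_one_line ltnS unfold_in /=; case: andP.
Qed.

Lemma runs_descent a w : all (fun c => c < a) w -> runs (a :: w) = [:: a] :: runs w.
Proof.
case: w => //= b w /andP[ba _]; have [r [rs /= ->]] := runs_shape b w.
by rewrite ltnNge (ltnW ba).
Qed.

End Words.

(** * The recurrence for the generating function *)

Section Weights.
Local Set Implicit Arguments.
Local Unset Strict Implicit.
Variables (R : comNzRingType) (x y q : R).

Definition word_weight (w : seq nat) : R :=
  x ^+ nb_runs 1 w * y ^+ nb_runs 2 w * q ^+ word_inv w.

Lemma word_weight_single n w : all (fun c => c <= n)%N w -> size w = n ->
  word_weight (n.+1 :: w) = x * q ^+ n * word_weight w.
Proof.
move=> w_le sz_w; rewrite /word_weight /nb_runs runs_descent //=.
have -> : count (fun c => c < n.+1)%N w = n.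
  by apply/eqP; rewrite -[X in _ == X]sz_w -all_count.
rewrite !add0n add1n exprS exprD; ring.
Qed.

(** Each of the two new letters is inverted with all [n] letters of [w], but not with the other;
    together they form one run. *)
Lemma word_weight_double n w : all (fun c => c <= n)%N w -> size w = n ->
  word_weight [:: n.+1, n.+2 & w] = y * q ^+ (2 * n) * word_weight w.
Proof.
move=> w_le sz_w.
have w_lt m : (n < m)%N -> all (fun c => c < m)%N w.
  by move=> ltnm; apply: sub_all w_le => c le_cn; apply: leq_ltn_trans le_cn ltnm.
have w_inv m : (n < m)%N -> count (fun c => c < m)%N w = n.
  by move/w_lt; rewrite all_count sz_w => /eqP.
(* The run of [n.+2] is first isolated from [w]; [n.+1] then joins it. *)
rewrite /word_weight /nb_runs /=; have := runs_descent (w_lt n.+2 (leqnSn _)).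
rewrite /= => ->; rewrite ltnSn /= add0n add1n ltnNge leqnSn /= !w_inv //.
by rewrite mul2n -addnn exprS !exprD; ring.
Qed.

Lemma F_I_word_weight n : F_I n x y q = \sum_(w <- block_words n) word_weight w.
Proof.
rewrite -(perm_big _ (perm_one_line_avoiders n)) big_map big_enum.
by apply: eq_bigr => pi _; rewrite /word_weight -inv_statE.
Qed.

Lemma F_I_SS n :
  F_I n.+2 x y q = x * q ^+ n.+1 * F_I n.+1 x y q + y * q ^+ (2 * n) * F_I n x y q.
Proof.
rewrite !F_I_word_weight block_wordsSS big_cat !big_map !mulr_sumr.
congr (_ + _); apply: eq_big_seq => w w_in.
  by rewrite word_weight_single ?(block_words_size w_in) ?block_words_le.
by rewrite word_weight_double ?(block_words_size w_in) ?block_words_le.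
Qed.

(** * The recurrence for the closed form *)

Definition closed_term n k : R :=
  'C(n - k, k)%:R * x ^+ (n - 2 * k) * y ^+ k * q ^+ ('C(n, 2) - k).

Definition closed_form n : R :=
  \sum_(k < n.+1 | (2 * k <= n)%N) closed_term n k.

(* The terms with [2 k > n] vanish, so the range may be enlarged at will. *)
Lemma closed_form_widen n N : (n < N)%N -> closed_form n = \sum_(k < N) closed_term n k.
Proof.
move=> ltnN; rewrite /closed_form (big_ord_widen_cond N (fun k => (2 * k <= n)%N)) //.
rewrite big_mkcond; apply: eq_bigr => k _; case: ifP => // /negbT k_large.
by rewrite /closed_term bin_small ?mul0r //; lia.
Qed.

(** This is Pascal's rule for ['C((n - k).+1, k.+1)], with matching exponents of [x], [y] and
    [q]. *)
Lemma closed_term_SS n k :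
  closed_term n.+2 k.+1 =
  x * q ^+ n.+1 * closed_term n.+1 k.+1 + y * q ^+ (2 * n) * closed_term n k.
Proof.
rewrite /closed_term.
(* For [2 * k > n] all three binomial coefficients vanish. *)
have [le2k|lt2k] := leqP (2 * k) n; last first.
  have small a b : (a < b)%N -> 'C(a, b)%:R = 0 :> R by move/bin_small->.
  by rewrite !small ?mul0r ?mulr0 ?addr0 //; lia.
have -> : (n.+2 - k.+1 = (n - k).+1)%N by lia.
have -> : (n.+1 - k.+1 = n - k)%N by lia.
have C1 : ('C(n.+1, 2) = 'C(n, 2) + n)%N by rewrite binS bin1.
have C2 : ('C(n.+2, 2) = 'C(n, 2) + n + n.+1)%N by rewrite binS bin1 C1.
(* This bound ensures that the exponent of [q] is not truncated. *)
have le_k : (k <= 'C(n, 2))%N by rewrite bin2; lia.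
have -> : ('C(n.+2, 2) - k.+1 = 2 * n + ('C(n, 2) - k))%N by lia.
have -> : (n.+2 - 2 * k.+1 = n - 2 * k)%N by lia.
rewrite binS natrD exprD (exprS y).
(* If [n = 2 * k], the term in [x] is zero; otherwise [n] is positive and [n.-1] is a true
   predecessor. *)
have [ek|nk] := leqP (2 * k).+1 n; last first.
  by rewrite (@bin_small (n - k) k.+1) ?mul0r; last lia; ring.
have -> : ('C(n.+1, 2) - k.+1 = ('C(n, 2) - k) + n.-1)%N by lia.
have -> : (n - 2 * k = (n.+1 - 2 * k.+1).+1)%N by lia.
have -> : (2 * n = n.+1 + n.-1)%N by lia.
by rewrite !exprD exprS; ring.
Qed.

(** With index 0 split off from the first two sums, index [k.+1] there pairs with index [k] in the
    last one, whence the ranges [n.+3] and [n.+2]. *)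
Lemma closed_form_SS n :
  closed_form n.+2 =
  x * q ^+ n.+1 * closed_form n.+1 + y * q ^+ (2 * n) * closed_form n.
Proof.
rewrite (@closed_form_widen _ n.+3) // (@closed_form_widen n.+1 n.+3) //.
rewrite (@closed_form_widen n n.+2) // 2!(@big_ord_recl _ _ _ n.+2).
rewrite mulrDr !mulr_sumr -addrA -big_split; congr (_ + _); last first.
  by apply: eq_bigr => k _; rewrite closed_term_SS.
(* The terms of index 0 agree because ['C(n.+2, 2) = 'C(n.+1, 2) + n.+1]. *)
by rewrite /closed_term !subn0 !bin0 (binS n.+1) bin1 exprS exprD; ring.
Qed.

End Weights.

Theorem theorem4p2 (R : comNzRingType) (n : nat) (x y q : R) :
  F_I n x y q =
  \sum_(k < n.+1 | (2 * k <= n)%N)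
     'C(n - k, k)%:R * x ^+ (n - 2 * k) * y ^+ k * q ^+ ('C(n, 2) - k).
Proof.
rewrite -/(closed_form x y q n).
elim/nat_ind2: n => [||n IH0 IH1]; last by rewrite F_I_SS closed_form_SS IH0 IH1.
  rewrite F_I_word_weight big_seq1 (@closed_form_widen _ _ _ _ _ 1) // big_ord1.
  by rewrite /closed_term mul1r.
(* For [n = 1] the term of index 1 vanishes since ['C(0, 1) = 0]. *)
rewrite F_I_word_weight big_seq1 (@closed_form_widen _ _ _ _ _ 2) //.
by rewrite !big_ord_recl big_ord0 /closed_term /= !mul0r !addr0 mul1r.
Qed.
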